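(* Let $X$ and $Y$ be real Hilbert spaces, $A\in\mathcal L(X,Y)$, $K_r\subset X$ a bounded closed convex set containing $0$, $P_r=\operatorname{cone}(K_r)$, and $b\in Y$. For $\varepsilon\ge0$ consider $$(\mathcal P_\varepsilon):\ \inf\Big\{\tfrac12 j_{K_r}^2(x) : x\in X,\ \|Ax-b\|_Y\le\varepsilon\Big\},\qquad (\mathcal D_\varepsilon):\ \inf_{y\in Y}\ \tfrac12\sigma_{K_r}^2(A^*y)-\langle b,y\rangle_Y+\varepsilon\|y\|_Y .$$ Assume that for all $y\in Y$, $A^*y\in \operatorname{sing}(K_r)^c\cup P_r^\circ$. (i) If $b\in\overline{A(P_r)}$ and $\varepsilon>0$, then, with $x_\varepsilon^\star$ a solution of $(\mathcal P_\varepsilon)$ and $y_\varepsilon^\star$ the unique solution of $(\mathcal D_\varepsilon)$, $$\{x_\varepsilon^\star\}=\sigma_{K_r}(A^*y_\varepsilon^\star)\,\partial\sigma_{K_r}(A^*y_\varepsilon^\star).$$ (ii) If $b\in A(P_r)$ and $(\mathcal D_0)$ admits a solution $y^\star$, then, with $x^\star$ a solution of $(\mathcal P_0)$, $$\{x^\star\}=\sigma_{K_r}(A^*y^\star)\,\partial\sigma_{K_r}(A^*y^\star).$$ That is, in each case membership of a point of $X$ in the right-hand set is necessary and sufficient for that point to be a solution of the corresponding primal problem.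
   Context: $\mathcal L(X,Y)$ is the space of bounded linear operators; $A^*\in\mathcal L(Y,X)$ is the Hilbert adjoint. For $C\subset X$ containing $0$, $\operatorname{cone}(C)=\{\lambda c:\lambda\ge0,\ c\in C\}$. $\sigma_{K_r}(x)=\sup_{v\in K_r}\langle x,v\rangle_X$ is the support function, $j_{K_r}(x)=\inf\{\alpha>0 : x\in\alpha K_r\}\in[0,+\infty]$ the gauge function, $\partial\sigma_{K_r}(z)=\{v\in K_r:\langle z,v\rangle_X=\sigma_{K_r}(z)\}$ the subdifferential of $\sigma_{K_r}$ at $z$. $\operatorname{sing}(K_r)$ is the set of $z\in X$ such that $\partial\sigma_{K_r}(z)$ is not a singleton, and $\operatorname{sing}(K_r)^c$ its complement in $X$. $P_r^\circ=\{x\in X:\langle x,v\rangle_X\le0\ \forall v\in P_r\}$. A solution of an optimisation problem is a minimiser with finite value. (Under the respective conditions on $b$, solutions of $(\mathcal P_\varepsilon)$ for $\varepsilon>0$, resp. $(\mathcal P_0)$, exist, and for $\varepsilon>0$ the solution of $(\mathcal D_\varepsilon)$ exists and is unique.) *)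

(* Defs.v *)
From HB Require Import structures.
From mathcomp Require Import all_boot all_order all_algebra.
From mathcomp Require Import all_classical all_reals all_analysis.

Set Implicit Arguments.
Unset Strict Implicit.
Unset Printing Implicit Defensive.

Import Order.TTheory GRing.Theory Num.Theory.
Import numFieldNormedType.Exports.

Local Open Scope classical_set_scope.
Local Open Scope ring_scope.

HB.mixin Record CompleteNormedModule_isHilbert (R : realType) X
    of CompleteNormedModule R X := {
  inner : {dot X for @idfun R} ;
  inner_norm : forall x : X, inner x x = `|x| ^+ 2
}.

#[short(type="hilbertType")]
HB.structure Definition Hilbert (R : realType) :=
  {X of CompleteNormedModule R X & CompleteNormedModule_isHilbert R X}.

(* For a bounded linear [A], the Riesz theorem gives, for each [y], exactly one
   [z] with the property below, so the default value 0 plays no role. *)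
Definition adjoint (R : realType) (X Y : hilbertType R) (A : X -> Y) (y : Y)
  : X := xget 0 [set z : X | forall x : X, inner (A x) y = inner x z].

Definition cone (R : realType) (X : lmodType R) (C : set X) : set X :=
  [set l *: c | l in [set l : R | 0 <= l] & c in C].

Section convex_body.
Context (R : realType) (X : hilbertType R).
Implicit Types (K P : set X) (x z v : X).

(* [sup] is the real supremum (0 on unbounded sets); [K] is meant to be
   nonempty and bounded, so that it is the supremum in the extended reals. *)
Definition support_fun K x : R := sup [set inner x v | v in K].

Definition gauge K x : \bar R :=
  ereal_inf [set a%:E | a in [set a : R | 0 < a /\ [set a *: v | v in K] x]].

Definition subdiff_support K z : set X :=
  [set v | K v /\ inner z v = support_fun K z].

Definition sing K : set X :=
  [set z | ~ exists v, subdiff_support K z = [set v]].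

Definition polar P : set X := [set x | forall v, P v -> inner x v <= 0].

End convex_body.

Definition is_solution (R : realType) (T : Type) (S : set T) (f : T -> \bar R)
  (x : T) : Prop :=
  [/\ S x, (f x \is a fin_num)%E & forall x', S x' -> (f x <= f x')%E].

Section problems.
Context (R : realType) (X Y : hilbertType R) (A : X -> Y) (K : set X) (b : Y).
Implicit Type eps : R.

Definition primal_solution eps : X -> Prop :=
  is_solution [set x | `|A x - b| <= eps]
    (fun x => (2^-1)%:E * gauge K x ^+ 2)%E.

Definition dual_solution eps : Y -> Prop :=
  is_solution [set: Y]
    (fun y => (2^-1 * support_fun K (adjoint A y) ^+ 2
               - inner b y + eps * `|y|)%:E).

Definition primal_from_dual (y : Y) : set X :=
  [set support_fun K (adjoint A y) *: v
    | v in subdiff_support K (adjoint A y)].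

End problems.

(* Main.v *)
Require Import Defs.
From HB Require Import structures.
From mathcomp Require Import all_boot all_order all_algebra.
From mathcomp Require Import all_classical all_reals all_analysis.
From mathcomp Require Import ring lra.
Import Order.TTheory GRing.Theory Num.Theory.
Import numFieldNormedType.Exports.
Local Open Scope classical_set_scope.
Local Open Scope ring_scope.

(** First-order optimality of a dual solution produces a feasible primal point
whose gauge meets the lower bound of weak duality, and the equality case of
that bound singles this point out. Write [z = A^* y] and [s = sigma_K(z)] for a
dual solution [y].

The hypothesis on [A^* y] makes [sigma_K^2 / 2] differentiable at [z] in every
direction: outside [sing K] the only maximiser [v] of [<z, .>] on [K] is the
gradient of [sigma_K], so the gradient of [sigma_K^2 / 2] is [s v]; on the
polar cone [s = 0], and [sigma_K^2] vanishes to second order. In both cases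
[s * subdiff_support K z] is a single point [x], and this [x] is that gradient
([half_sqr_support_deriv]).

Optimality of [y] then says two things. Moving [y] in the direction
[h = b - A x] changes the dual objective at rate at most
[|h| (eps - |h|)], so [|A x - b| <= eps]: the candidate is feasible
([dual_solution_feasible]). Moving [y] along its own ray gives
[s^2 = <b, y> - eps |y|], and therefore [s^2 <= <z, x'>] for every feasible
[x'] ([support_sqr_le_inner]). As [<z, x'> <= j_K(x') s], every feasible
point has gauge at least [s], while [x = s v] has gauge at most [s]; so [x] is
optimal. Conversely a solution [x'] has gauge [s]; for [s > 0] the closed
set [K] contains [x' / s], which attains the supremum [sigma_K(z)] by
[s^2 <= <z, x'>], and for [s = 0] boundedness of [K] forces [x' = 0].

The only compactness used is that nested closed bounded convex sets in a
Hilbert space have a common point ([nested_convex_nonempty]). It yields the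
Riesz representation, hence the adjoint identity, and the limit of
near-maximisers that gives the directional derivative of [sigma_K]. *)

(** * Inner products *)

Lemma innerC {R : realType} {X : hilbertType R} (x y : X) :
  inner x y = inner y x.
Proof. by rewrite hermC expr0 mul1r. Qed.

Lemma innerDl {R : realType} {X : hilbertType R} (x y z : X) :
  inner (x + y) z = inner x z + inner y z.
Proof. exact: linearDl. Qed.

Lemma innerDr {R : realType} {X : hilbertType R} (x y z : X) :
  inner x (y + z) = inner x y + inner x z.
Proof. exact: linearDr. Qed.

Lemma innerZl {R : realType} {X : hilbertType R} (a : R) (x y : X) :
  inner (a *: x) y = a * inner x y.
Proof. exact: linearZl_LR. Qed.

Lemma innerZr {R : realType} {X : hilbertType R} (a : R) (x y : X) :
  inner x (a *: y) = a * inner x y.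
Proof. exact: linearZr_LR. Qed.

Lemma innerNl {R : realType} {X : hilbertType R} (x y : X) :
  inner (- x) y = - inner x y.
Proof. by rewrite -scaleN1r innerZl mulN1r. Qed.

Lemma innerNr {R : realType} {X : hilbertType R} (x y : X) :
  inner x (- y) = - inner x y.
Proof. by rewrite -scaleN1r innerZr mulN1r. Qed.

Lemma inner0r {R : realType} {X : hilbertType R} (x : X) : inner x 0 = 0.
Proof. by rewrite -(scale0r (0 : X)) innerZr mul0r. Qed.

Lemma inner_eqr {R : realType} {X : hilbertType R} (y z : X) :
  (forall x, inner x y = inner x z) -> y = z.
Proof.
move=> yz; apply/eqP; rewrite -subr_eq0 -normr_eq0 -sqrf_eq0 -inner_norm.
by rewrite {2}(_ : y - z = y + - z)// innerDr innerNr yz subrr.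
Qed.

Lemma normD_sqr {R : realType} {X : hilbertType R} (x y : X) :
  `|x + y| ^+ 2 = `|x| ^+ 2 + 2 * inner x y + `|y| ^+ 2.
Proof.
rewrite -!inner_norm innerDl !innerDr (innerC y x); ring.
Qed.

Lemma parallelogram {R : realType} {X : hilbertType R} (x y : X) :
  `|x - y| ^+ 2 = 2 * `|x| ^+ 2 + 2 * `|y| ^+ 2 - `|x + y| ^+ 2.
Proof. by rewrite !normD_sqr normrN innerNr; ring. Qed.

Lemma inner_le_norm {R : realType} {X : hilbertType R} (x y : X) :
  inner x y <= `|x| * `|y|.
Proof.
have : `|x + y| ^+ 2 <= (`|x| + `|y|) ^+ 2.
  by rewrite lerXn2r ?nnegrE ?ler_normD// addr_ge0.
rewrite normD_sqr sqrrD; lra.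
Qed.

(** First-order condition for a quadratic minimised at the interior point 0;
it serves both the Riesz representation and the dual optimality along the ray
of the dual solution. *)
Lemma quadratic_ge0_linear_eq0 (R : realFieldType) (a c : R) :
  (forall t, `|t| <= 1 -> 0 <= t * c + t ^+ 2 * a) -> c = 0.
Proof.
move=> h; apply/eqP; apply: contraT => c0.
have nc : 0 < `|c| by rewrite normr_gt0.
have D0 : 0 < `|c| + `|a| by rewrite ltr_wpDr.
(* For small steps against the sign of [c] the linear term wins. *)
have := h (- c / (`|c| + `|a|)); rewrite normrM normrN normfV (gtr0_norm D0).
rewrite ler_pdivrMr// mul1r lerDl normr_ge0 => /(_ isT).
rewrite (_ : _ + _ = (`|c| / (`|c| + `|a|)) ^+ 2 * (a - (`|c| + `|a|))).
  rewrite pmulr_rge0; first by have := ler_norm a; lra.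
  by rewrite exprn_gt0// divr_gt0.
rewrite [in RHS]expr_div_n real_normK ?num_real//; field.
exact: lt0r_neq0.
Qed.

(** * Nested convex sets and the Riesz representation *)
Lemma harmonic_le {R : realType} (m n : nat) :
  (m <= n)%N -> harmonic n <= harmonic m :> R.
Proof. by move=> mn; rewrite /harmonic lef_pV2 ?posrE ?ltr0n// ler_nat. Qed.

Lemma le_of_sub_harmonic {R : realType} (s a : R) :
  (forall n, s - harmonic n <= a) -> s <= a.
Proof.
move=> sa; have h : (fun n => s - @harmonic R n) @ \oo --> s - 0.
  by apply: cvgB; [exact: cvg_cst|exact: cvg_harmonic].
rewrite -[s]subr0 -(cvg_lim _ h)//; apply: limr_le; last exact: nearW.
by apply/cvg_ex; eexists; exact: h.
Qed.

Lemma convex_setP {R : realType} {X : lmodType R} (K : set X) :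
  convex_set K <-> (forall x y l, 0 <= l <= 1 -> K x -> K y ->
    K (l *: x + (1 - l) *: y)).
Proof.
split=> [cK x y l /andP[l0 l1] Kx Ky|cK x y l /set_mem Kx /set_mem Ky].
  by have /set_mem := cK x y (Itv01 l0 l1) (mem_set Kx) (mem_set Ky).
by apply/mem_set; apply: cK => //; rewrite ge0 le1.
Qed.

Lemma convex_setI2 {R : realType} {X : lmodType R} (K L : set X) :
  convex_set K -> convex_set L -> convex_set (K `&` L).
Proof.
move=> /convex_setP cK /convex_setP cL; apply/convex_setP.
by move=> x y l l01 [Kx Lx] [Ky Ly]; split; [exact: cK|exact: cL].
Qed.

Lemma convex_superlevel {R : realType} {X : lmodType R} (f : X -> R) (c : R) :
  (forall x y l, 0 <= l -> 0 <= 1 - l ->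
    l * f x + (1 - l) * f y <= f (l *: x + (1 - l) *: y)) ->
  convex_set [set x | c <= f x].
Proof.
move=> fcc; apply/convex_setP => x y l /andP[l0 l1] /= cx cy.
have l1' : 0 <= 1 - l by rewrite subr_ge0.
apply: le_trans (fcc _ _ _ l0 l1').
by have := ler_wpM2l l0 cx; have := ler_wpM2l l1' cy; lra.
Qed.

(** The one-sided bound is the Lipschitz condition, since [x] and [y] may be
exchanged. *)
Lemma closed_superlevel {R : realType} {X : normedModType R} (f : X -> R)
    (L c : R) :
  (forall x y, f x - f y <= L * `|x - y|) -> closed [set x | c <= f x].
Proof.
move=> fL x clx /=; rewrite leNgt; apply/negP => fxc.
have L0 : 0 < `|L| + 1 by rewrite ltr_wpDl.
have e0 : 0 < (c - f x) / (`|L| + 1) by rewrite divr_gt0 ?subr_gt0.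
have [y [/= cy]] := clx _ (nbhsx_ballx x _ e0).
rewrite -ball_normE /= distrC ltr_pdivlMr// => xy.
have := fL y x; have : L * `|y - x| <= (`|L| + 1) * `|y - x|.
  by rewrite ler_wpM2r// (le_trans (ler_norm L))// lerDl.
lra.
Qed.

(** A substitute for weak compactness. Points [u n] of [C n] of nearly minimal
norm form a Cauchy sequence: the midpoint of two late ones still lies in an
early [C k], hence is not much shorter than they are, and the parallelogram
identity bounds their distance. *)
Lemma nested_convex_nonempty {R : realType} {X : hilbertType R}
    (C : nat -> set X) (M : R) :
  (forall n, closed (C n)) -> (forall n, convex_set (C n)) ->
  (forall m n, (m <= n)%N -> C n `<=` C m) ->
  (forall n, C n !=set0) -> (forall n x, C n x -> `|x| <= M) ->
  exists x, forall n, C n x.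
Proof.
move=> clC cvC dC C0 CM.
pose N n := [set `|x| | x in C n].
pose d n := inf (N n).
have N0 n : N n !=set0 by have [x Cx] := C0 n; exists `|x|, x.
have Nlb n : has_lbound (N n) by exists 0 => _ [x _ <-].
have d_le n x : C n x -> d n <= `|x|.
  by move=> Cx; apply: ge_inf => //; exists x.
have d_ge0 n : 0 <= d n by apply: lb_le_inf => // _ [x _ <-].
have dM n : d n <= M.
  by have [x Cx] := C0 n; exact: le_trans (d_le _ _ Cx) (CM _ _ Cx).
have d_nd : nondecreasing_seq d.
  by move=> m n mn; apply: lb_le_inf => // _ [x Cx <-]; apply/d_le/(dC _ _ mn).
have dub : has_ubound (range d) by exists M => _ [n _ <-].
pose l := sup (range d).
have dl : d @ \oo --> l by exact: nondecreasing_cvgn.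
have d_lel n : d n <= l by apply: ub_le_sup => //; exists n.
(* Bound on the squared distance of two points of [C n] that are shorter than
   [l + harmonic n], their midpoint being at least [d n] long. *)
pose g n := 4 * ((l + harmonic n) ^+ 2 - d n ^+ 2).
have g0 : g @ \oo --> (0 : R).
  rewrite (_ : 0 = 4 * ((l + 0) ^+ 2 - l ^+ 2)); last first.
    by rewrite addr0 subrr mulr0.
  apply: cvgM; first exact: cvg_cst.
  apply: cvgB; last exact: (cvgM dl dl).
  have lh : (fun n => l + @harmonic R n) @ \oo --> l + 0.
    by apply: cvgD; [exact: cvg_cst|exact: cvg_harmonic].
  exact: (cvgM lh lh).
have /choice[u Hu] : forall n, exists x, C n x /\ `|x| < l + harmonic n.
  move=> n; have : inf (N n) < l + harmonic n.
    by rewrite (le_lt_trans (d_lel n))// ltrDl harmonic_gt0.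
  by move=> /(inf_lt (N0 n))[_ [x Cx <-] xl]; exists x.
have u_close k m n : (k <= m)%N -> (k <= n)%N -> `|u m - u n| ^+ 2 <= g k.
  move=> km kn; have [Cm um] := Hu m; have [Cn un] := Hu n.
  have ub i : (k <= i)%N -> `|u i| < l + harmonic i ->
      `|u i| ^+ 2 <= (l + harmonic k) ^+ 2.
    move=> ki ui; rewrite lerXn2r ?nnegrE//.
      by rewrite addr_ge0// ?harmonic_ge0// (le_trans (d_ge0 0)).
    apply/ltW/(lt_le_trans ui); rewrite lerD2l.
    exact: harmonic_le.
  have : d k ^+ 2 <= `|2^-1 *: (u m + u n)| ^+ 2.
    rewrite lerXn2r ?nnegrE//; apply: d_le.
    rewrite scalerDr [X in _ + X *: _](_ : 2^-1 = 1 - 2^-1); last by field.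
    have /convex_setP := cvC k; apply; first lra.
      exact: dC km _ Cm.
    exact: dC kn _ Cn.
  rewrite normrZ exprMn gtr0_norm// parallelogram /g.
  have := ub _ km um; have := ub _ kn un; lra.
have /cvg_ex[x ux] : cvg (u @ \oo).
  apply: cauchy_cvg; apply/cauchy_ballP => e e0.
  have e20 : 0 < e ^+ 2 by rewrite exprn_gt0.
  have [k _ /(_ k (leqnn k)) /= gk] : \forall n \near \oo, `|g n| < e ^+ 2.
    by apply: cvgr0_norm_lt.
  exists (u @` [set n | (k <= n)%N], u @` [set n | (k <= n)%N]).
    by split; exists k => // n kn /=; exists n.
  move=> [_ _] /= [[m km <-] [n kn <-]]; rewrite -ball_normE /=.
  rewrite -(@ltr_pXn2r _ 2) ?nnegrE ?(ltW e0)//.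
  exact: le_lt_trans (u_close _ _ _ km kn) (le_lt_trans (ler_norm _) gk).
exists x => n; apply: (closed_cvg (C n) (clC n) _ x ux).
by exists n => // m nm; apply: dC nm _ _; have [] := Hu m.
Qed.

(** A maximiser [u] of [f] on the unit ball exists as a common point of the
nested near-maximal slices. With [S = f u], the inequality
[f x ^+ 2 <= S ^+ 2 * `|x| ^+ 2] is an equality at [u], and its first-order
condition there is the representation by [S *: u]. *)
Lemma riesz {R : realType} {X : hilbertType R} (f : X -> R) (L : R) :
  (forall a x y, f (a *: x + y) = a * f x + f y) ->
  (forall x, f x <= L * `|x|) ->
  exists z, forall x, f x = inner x z.
Proof.
move=> flin fL.
have f0 : f 0 = 0 by have := flin (-1) 0 0; rewrite scaler0 addr0; lra.
have fZ a x : f (a *: x) = a * f x by rewrite -[a *: x]addr0 flin f0 addr0.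
have fD x y : f (x + y) = f x + f y by rewrite -[x in LHS]scale1r flin mul1r.
have fB x y : f (x - y) = f x - f y by rewrite fD -scaleN1r fZ mulN1r.
(* The unit ball as a superlevel set of the concave function [- `|x|]. *)
pose B := [set x : X | -1 <= - `|x|].
have BE x : B x <-> `|x| <= 1 by rewrite /B /= lerN2.
pose V := [set f x | x in B].
have V0 : V !=set0 by exists (f 0), 0 => //; apply/BE; rewrite normr0.
have Vub : has_ubound V.
  exists `|L| => _ [x /BE x1 <-]; rewrite (le_trans (fL x))//.
  rewrite (le_trans (ler_wpM2r _ (ler_norm L)))//.
  by rewrite -[leRHS]mulr1 ler_wpM2l.
pose S := sup V.
have [u Cu] : exists u, forall n, (B `&` [set x | S - @harmonic R n <= f x]) u.
  apply: (@nested_convex_nonempty _ _ _ 1).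
  - move=> n; apply: closedI.
      apply: (@closed_superlevel _ _ _ 1) => x y.
      by have := ler_distD x y 0; rewrite !subr0 distrC mul1r; lra.
    by apply: (@closed_superlevel _ _ _ L) => x y; rewrite -fB.
  - move=> n; apply: convex_setI2; apply: convex_superlevel => x y l l0 l1.
      have := ler_normD (l *: x) ((1 - l) *: y); rewrite !normrZ.
      by rewrite (ger0_norm l0) (ger0_norm l1); lra.
    by rewrite flin fZ.
  - move=> m n mn x [Bx fx]; split=> //=; apply: le_trans fx; rewrite /= lerB//.
    exact: harmonic_le.
  - move=> n; have : S - harmonic n < sup V.
      by rewrite ltrBlDr ltrDl harmonic_gt0.
    by move=> /(sup_gt V0)[_ [x Bx <-] fx]; exists x; split=> //; exact: ltW.
  - by move=> n x [/BE].
have u1 : `|u| <= 1 by apply/BE; have [] := Cu 0%N.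
have fS x : `|x| <= 1 -> f x <= S.
  by move=> x1; apply: ub_le_sup => //; exists x => //; apply/BE.
have fu : f u = S.
  apply/eqP; rewrite eq_le fS//=.
  by apply: le_of_sub_harmonic => n; have [] := Cu n.
have S0 : 0 <= S by rewrite -f0 fS// normr0.
have fsq x : f x ^+ 2 <= S ^+ 2 * `|x| ^+ 2.
  have [->|x0] := eqVneq x 0; first by rewrite f0 normr0 expr0n mulr0.
  have nx : 0 < `|x| by rewrite normr_gt0.
  have fle (y : X) : `|y| = `|x| -> f y <= S * `|x|.
    move=> yx; have : f (`|x|^-1 *: y) <= S.
      by apply: fS; rewrite normrZ yx ger0_norm ?mulVf ?gt_eqF// invr_ge0.
    by rewrite fZ mulrC ler_pdivrMr.
  rewrite -exprMn -real_normK ?num_real// lerXn2r ?nnegrE ?mulr_ge0//.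
  by rewrite ler_norml fle// -lerN2 opprK -mulN1r -fZ scaleN1r fle// normrN.
exists (S *: u) => x; rewrite innerZr.
have [S00|Sn0] := eqVneq S 0.
  have := fsq x; rewrite S00 expr0n mul0r mul0r => fx.
  by apply/eqP; rewrite -sqrf_eq0 eq_le fx sqr_ge0.
have Sp : 0 < S by rewrite lt_neqAle eq_sym Sn0.
have : 2 * S * (S * inner u x - f x) = 0.
  apply: (@quadratic_ge0_linear_eq0 _ (S ^+ 2 * `|x| ^+ 2 - f x ^+ 2)) => t _.
  have := fsq (u + t *: x); rewrite fD fZ fu normD_sqr innerZr normrZ.
  rewrite exprMn real_normK ?num_real//.
  have : S ^+ 2 * `|u| ^+ 2 <= S ^+ 2.
    by rewrite -[leRHS]mulr1 ler_wpM2l ?sqr_ge0// exprn_ile1.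
  nra.
move=> /eqP; rewrite !mulf_eq0 pnatr_eq0 (negPf Sn0)/= subr_eq0 innerC.
by move=> /eqP ->.
Qed.

Lemma adjointP {R : realType} {X Y : hilbertType R} (A : {linear X -> Y})
    (hA : bounded_near A (nbhs (0 : X))) (x : X) (y : Y) :
  inner (A x) y = inner x (adjoint A y).
Proof.
suff: exists z, forall x, inner (A x) y = inner x z.
  by move=> /(xgetPex 0); exact.
have /linear_boundedP[L [_ /(_ (L + 1))]] := hA.
rewrite ltrDl ltr01 => /(_ isT) AL.
apply: (@riesz _ _ _ ((L + 1) * `|y|)) => [a u v|u].
  by rewrite linearP innerDl innerZl.
rewrite (le_trans (inner_le_norm _ _))// mulrAC ler_wpM2r//.
Qed.

Lemma adjointD {R : realType} {X Y : hilbertType R} (A : {linear X -> Y})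
    (hA : bounded_near A (nbhs (0 : X))) (y h : Y) :
  adjoint A (y + h) = adjoint A y + adjoint A h.
Proof.
by apply: inner_eqr => x; rewrite innerDr -!(adjointP A hA) innerDr.
Qed.

Lemma adjointZ {R : realType} {X Y : hilbertType R} (A : {linear X -> Y})
    (hA : bounded_near A (nbhs (0 : X))) (a : R) (y : Y) :
  adjoint A (a *: y) = a *: adjoint A y.
Proof.
by apply: inner_eqr => x; rewrite innerZr -!(adjointP A hA) innerZr.
Qed.

(** * Support functions and their directional derivatives *)
Lemma bounded_set_norm {R : realType} {X : normedModType R} (K : set X) :
  bounded_set K -> exists2 M, 0 <= M & forall v, K v -> `|v| <= M.
Proof.
move=> [M [_ KM]]; exists (`|M| + 1); first by rewrite addr_ge0.
by apply: KM; rewrite (le_lt_trans (ler_norm M))// ltrDl.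
Qed.

Lemma support_fun_ub {R : realType} {X : hilbertType R} {K : set X}
    (K_bounded : bounded_set K) (z v : X) :
  K v -> inner z v <= support_fun K z.
Proof.
move=> Kv; apply: ub_le_sup; last by exists v.
have [M M0 KM] := bounded_set_norm _ K_bounded.
exists (`|z| * M) => _ [w Kw <-]; rewrite (le_trans (inner_le_norm _ _))//.
by rewrite ler_wpM2l// KM.
Qed.

Lemma support_fun_le {R : realType} {X : hilbertType R} {K : set X} (K0 : K 0)
    (z : X) (c : R) :
  (forall v, K v -> inner z v <= c) -> support_fun K z <= c.
Proof.
move=> Kc; apply: ge_sup; first by exists (inner z 0), 0.
by move=> _ [v Kv <-]; exact: Kc.
Qed.

Lemma support_fun_gt {R : realType} {X : hilbertType R} {K : set X} (K0 : K 0)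
    (z : X) (c : R) :
  c < support_fun K z -> exists2 v, K v & c < inner z v.
Proof.
by move=> /sup_gt[|_ [v Kv <-] cv]; [exists (inner z 0), 0|exists v].
Qed.

Lemma support_fun_ge0 {R : realType} {X : hilbertType R} {K : set X}
    (K_bounded : bounded_set K) (K0 : K 0) (z : X) : 0 <= support_fun K z.
Proof. by rewrite -(inner0r z); exact: support_fun_ub. Qed.

Lemma support_funZ {R : realType} {X : hilbertType R} {K : set X}
    (K_bounded : bounded_set K) (K0 : K 0) (a : R) (z : X) :
  0 <= a -> support_fun K (a *: z) = a * support_fun K z.
Proof.
rewrite le_eqVlt => /predU1P[<-|a0].
  apply/eqP; rewrite eq_le mul0r support_fun_ge0// andbT.
  by apply: support_fun_le => // v _; rewrite innerZl mul0r.
apply/eqP; rewrite eq_le; apply/andP; split.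
  by apply: support_fun_le => // v Kv; rewrite innerZl ler_pM2l// support_fun_ub.
rewrite -ler_pdivlMl//; apply: support_fun_le => // v Kv.
by rewrite ler_pdivlMl// -innerZl support_fun_ub.
Qed.

Lemma support_funD {R : realType} {X : hilbertType R} {K : set X}
    (K_bounded : bounded_set K) (K0 : K 0) (y z : X) :
  support_fun K (y + z) <= support_fun K y + support_fun K z.
Proof.
by apply: support_fun_le => // v Kv; rewrite innerDl lerD// support_fun_ub.
Qed.

Lemma support_fun_polar {R : realType} {X : hilbertType R} {K : set X}
    (K_bounded : bounded_set K) (K0 : K 0) (z : X) :
  polar (cone K) z -> support_fun K z = 0.
Proof.
move=> Pz; apply/eqP; rewrite eq_le support_fun_ge0// andbT.
apply: support_fun_le => // v Kv; apply: Pz.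
by exists 1 => //=; exists v => //; rewrite scale1r.
Qed.

(** If the quotient stayed above [c = inner g v + e] for arbitrarily small [t],
near-maximisers [w] at [z + t *: g] would satisfy [c <= inner g w] and be
nearly maximal at [z]. A common point of these nested slices of [K] is a
maximiser at [z] other than [v]. *)
Lemma support_fun_deriv {R : realType} {X : hilbertType R} {K : set X}
    (K_bounded : bounded_set K) (K_closed : closed K) (K_convex : convex_set K)
    (K0 : K 0) (z v g : X) (e : R) :
  subdiff_support K z = [set v] -> 0 < e ->
  exists2 r, 0 < r & forall t, 0 < t < r ->
    support_fun K (z + t *: g) <= support_fun K z + t * (inner g v + e).
Proof.
move=> Kz e0; apply: contrapT => nr.
have [M M0 KM] := bounded_set_norm _ K_bounded.
set s := support_fun K z in nr; set c := inner g v + e in nr.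
pose C n := K `&` ([set w | s - @harmonic R n <= inner z w] `&`
                   [set w | c <= inner g w]).
have inner_lip (y u w : X) : inner y u - inner y w <= `|y| * `|u - w|.
  by rewrite -innerNr -innerDr inner_le_norm.
have inner_conc (y u w : X) l : 0 <= l -> 0 <= 1 - l ->
    l * inner y u + (1 - l) * inner y w <= inner y (l *: u + (1 - l) *: w).
  by rewrite innerDr !innerZr.
have [w Cw] : exists w, forall n, C n w.
  apply: (@nested_convex_nonempty _ _ _ M).
  - by move=> n; apply: closedI => //; apply: closedI;
      apply: closed_superlevel => *; exact: inner_lip.
  - by move=> n; apply: convex_setI2 => //; apply: convex_setI2;
      apply: convex_superlevel => *; exact: inner_conc.
  - move=> m n mn w [Kw [zw gw]]; split=> //; split=> //=; apply: le_trans zw.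
    by rewrite lerB// harmonic_le.
  (* [B] bounds [inner g w - c] on [K], so [t < harmonic n / B] costs at most
     [harmonic n] in [inner z w]. *)
  - move=> n; pose B := `|g| * M + `|c| + 1.
    have B0 : 0 < B by rewrite ltr_wpDl// addr_ge0// mulr_ge0.
    have [t [t0 tr st]] : exists t, [/\ 0 < t, t < harmonic n / B &
        s + t * c < support_fun K (z + t *: g)].
      apply: contrapT => nt; apply: nr; exists (harmonic n / B).
        by rewrite divr_gt0// harmonic_gt0.
      move=> t /andP[t0 tr]; rewrite leNgt; apply/negP => st.
      by apply: nt; exists t.
    have [w Kw] := support_fun_gt K0 _ _ st; rewrite innerDl innerZl => zw.
    have zs := support_fun_ub K_bounded z w Kw; rewrite -/s in zs.
    have gB : `|c| + inner g w <= B.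
      have := inner_le_norm g w; have := ler_wpM2l (normr_ge0 g) (KM _ Kw).
      rewrite /B; lra.
    suff [zl gl] : s - harmonic n <= inner z w /\ c <= inner g w by exists w.
    split; last first.
      by rewrite -(ler_pM2l t0); lra.
    rewrite ltr_pdivlMr// in tr.
    have : t * (inner g w - c) <= t * B.
      by rewrite ler_pM2l//; have := ler_norm (- c); rewrite normrN; lra.
    move: (harmonic n) tr => h; lra.
  - by move=> n w [Kw _]; exact: KM.
have gw : c <= inner g w by have [_ []] := Cw 0%N.
have Kw : K w by have [] := Cw 0%N.
suff: subdiff_support K z w.
  by rewrite Kz /= => wv; move: gw; rewrite wv /c; lra.
split=> //; apply/eqP; rewrite eq_le support_fun_ub//=.
by apply: le_of_sub_harmonic => n; have [_ []] := Cw n.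
Qed.

(** Squaring absorbs the points of the polar cone: there the support function
may fail to be differentiable, but it is zero and grows at most linearly, so
half its square has derivative zero. *)
Lemma half_sqr_support_deriv {R : realType} {X : hilbertType R} {K : set X}
    (K_bounded : bounded_set K) (K_closed : closed K) (K_convex : convex_set K)
    (K0 : K 0) (z : X) :
  (~` sing K `|` polar (cone K)) z ->
  exists2 x, [set support_fun K z *: v | v in subdiff_support K z] = [set x] &
    forall g e, 0 < e -> exists2 r, 0 < r & forall t, 0 < t < r ->
      2^-1 * support_fun K (z + t *: g) ^+ 2 <=
      2^-1 * support_fun K z ^+ 2 + t * (inner g x + e).
Proof.
set s := support_fun K z => zK.
have sg0 y : 0 <= support_fun K y by exact: support_fun_ge0.
have s0 : 0 <= s by exact: sg0.
(* It suffices to bound the growth of the support function itself by a slope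
   [c] such that [s * c] is almost [inner g x]; [c] may be large when [s = 0]. *)
suff [x xs xd] : exists2 x,
    [set s *: v | v in subdiff_support K z] = [set x] &
    forall g e, 0 < e -> exists c r, [/\ 0 < r, s * c <= inner g x + e &
      forall t, 0 < t < r -> support_fun K (z + t *: g) <= s + t * c].
  exists x => // g e e0; have e20 : 0 < e / 2 by lra.
  have [c [r [r0 sc cr]]] := xd g _ e20.
  have c10 : 0 < c ^+ 2 + 1 by rewrite ltr_wpDl// sqr_ge0.
  exists (Num.min r (e / (c ^+ 2 + 1))); first by rewrite lt_min r0 divr_gt0.
  move=> t /andP[t0]; rewrite lt_min ltr_pdivlMr// => /andP[tr te].
  have := cr t; rewrite t0 tr => /(_ isT) st.
  have : support_fun K (z + t *: g) ^+ 2 <= (s + t * c) ^+ 2.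
    by rewrite lerXn2r ?nnegrE// (le_trans _ st).
  have : t * (t * c ^+ 2) <= t * e by rewrite ler_pM2l//; lra.
  have := ler_wpM2l (ltW t0) sc; lra.
have [[v Kv]|s00] : (exists v, subdiff_support K z = [set v]) \/ s = 0.
  by case: zK => [/contrapT|zK]; [left|right; exact: support_fun_polar].
  exists (s *: v).
    by rewrite Kv; apply/seteqP; split => [_ [_ -> <-]//|_ ->]; exists v.
  move=> g e e0; have s10 : 0 < s + 1 by lra.
  have ee : 0 < e / (s + 1) by rewrite divr_gt0.
  have [r r0 sr] :=
    support_fun_deriv K_bounded K_closed K_convex K0 z v g _ Kv ee.
  exists (inner g v + e / (s + 1)), r; split => //.
  rewrite innerZr mulrDr lerD2l mulrCA ger_pMr// ler_pdivrMr//; lra.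
exists 0.
  apply/seteqP; split => [_ [v _ <-]|_ ->] /=; first by rewrite s00 scale0r.
  by exists 0; rewrite ?scaler0//; split; rewrite // inner0r -/s s00.
move=> g e e0; exists (support_fun K g), 1; split => //.
  by rewrite s00 mul0r inner0r add0r ltW.
move=> t /andP[t0 _]; rewrite -(support_funZ K_bounded K0 _ _ (ltW t0)).
exact: (support_funD K_bounded K0).
Qed.

(** * Gauge functions *)
Lemma gauge_ge0 {R : realType} {X : hilbertType R} (K : set X) (x : X) :
  (0 <= gauge K x)%E.
Proof. by apply: le_ereal_inf_tmp => _ [a [a0 _] <-]; rewrite lee_fin ltW. Qed.

Lemma gauge_lt {R : realType} {X : hilbertType R} (K : set X) (x : X) (a : R) :
  (gauge K x < a%:E)%E ->
  exists a' v, [/\ 0 < a' < a, (gauge K x <= a'%:E)%E, K v & x = a' *: v].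
Proof.
move=> /ereal_inf_lt[_ [a' [a'0 [v Kv vx]] <-]]; rewrite lte_fin => a'a.
exists a', v; split => //; first by rewrite a'0.
by apply: ereal_inf_lbound; exists a' => //; split => //; exists v.
Qed.

Lemma gauge_le_scale {R : realType} {X : hilbertType R} (K : set X) (K0 : K 0)
    (s : R) (v : X) : 0 <= s -> K v -> (gauge K (s *: v) <= s%:E)%E.
Proof.
rewrite le_eqVlt => /predU1P[<-|s0] Kv; last first.
  by apply: ereal_inf_lbound; exists s => //; split => //; exists v.
rewrite scale0r; apply/lee_addgt0Pr => e e0; rewrite add0e.
apply: ereal_inf_lbound; exists e => //; split => //.
by exists 0 => //; rewrite scaler0.
Qed.

Lemma inner_le_gauge {R : realType} {X : hilbertType R} {K : set X}
    (K_bounded : bounded_set K) (K0 : K 0) (x z : X) (j : R) :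
  gauge K x = j%:E -> inner z x <= j * support_fun K z.
Proof.
move=> xj; have s0 := support_fun_ge0 K_bounded K0 z.
apply/ler_addgt0Pr => e e0.
have s10 : 0 < support_fun K z + 1 by lra.
have [|a [v [/andP[a0 aj] _ Kv ->]]] :=
  @gauge_lt _ _ K x (j + e / (support_fun K z + 1)).
  by rewrite xj lte_fin ltrDl divr_gt0.
have zv := support_fun_ub K_bounded z v Kv.
rewrite innerZr (le_trans (ler_wpM2l (ltW a0) zv))//.
rewrite (le_trans (ler_wpM2r s0 (ltW aj)))// mulrDl lerD2l.
rewrite -mulrAC -mulrA ger_pMr// ler_pdivrMr//; lra.
Qed.

Lemma gauge_eq0 {R : realType} {X : hilbertType R} {K : set X}
    (K_bounded : bounded_set K) (x : X) : gauge K x = 0%E -> x = 0.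
Proof.
move=> x0; have [M M0 KM] := bounded_set_norm _ K_bounded.
apply/eqP; rewrite -normr_le0; apply/ler_addgt0Pr => e e0; rewrite add0r.
have M10 : 0 < M + 1 by lra.
have [|a [v [/andP[a0 aj] _ Kv ->]]] := @gauge_lt _ _ K x (e / (M + 1)).
  by rewrite x0 lte_fin divr_gt0.
rewrite normrZ gtr0_norm//; rewrite ltr_pdivlMr// in aj.
by have := ler_wpM2l (ltW a0) (KM v Kv); lra.
Qed.

(** The gauge is an infimum over [a > 0] with [a^-1 *: x] in [K]; closedness of
[K] lets [a] decrease to the infimum as long as that one is positive. *)
Lemma gauge_attained {R : realType} {X : hilbertType R} {K : set X}
    (K_closed : closed K) (x : X) (s : R) :
  0 < s -> gauge K x = s%:E -> K (s^-1 *: x).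
Proof.
move=> s0 xs.
have /choice[a Ha] : forall n, exists a,
    s <= a <= s + harmonic n /\ K (a^-1 *: x).
  move=> n; have [|a [v [/andP[a0 ah] + Kv xv]]] :=
    @gauge_lt _ _ K x (s + harmonic n).
    by rewrite xs lte_fin ltrDl harmonic_gt0.
  rewrite xs lee_fin => sa; exists a; rewrite sa ltW//; split => //.
  by rewrite xv scalerA mulVf ?scale1r// gt_eqF.
have sh : (fun n => s + @harmonic R n) @ \oo --> s + 0.
  by apply: cvgD; [exact: cvg_cst|exact: cvg_harmonic].
rewrite addr0 in sh.
have as_ : a @ \oo --> s.
  apply: squeeze_cvgr (cvg_cst s) sh.
  by apply: nearW => n; have [] := Ha n.
have : (fun n => (a n)^-1 *: x) @ \oo --> s^-1 *: x.
  by apply: cvgZr_tmp; apply: cvgV => //; rewrite gt_eqF.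
by apply: closed_cvg => //; apply: nearW => n; have [] := Ha n.
Qed.

Lemma half_sqr_le {R : realType} (s : R) (g : \bar R) :
  0 <= s -> (s%:E <= g)%E -> ((2^-1 * s ^+ 2)%:E <= (2^-1)%:E * g ^+ 2)%E.
Proof.
move=> s0; case: g => [j| |//]; last first.
  by rewrite expe2 mulyy gt0_muley ?leey// lte_fin.
rewrite lee_fin -EFin_expe -EFinM lee_fin => sj.
by rewrite ler_pM2l// lerXn2r// nnegrE (le_trans s0).
Qed.

Lemma half_sqr_le_eq {R : realType} (s : R) (g : \bar R) :
  0 <= s -> (s%:E <= g)%E ->
  ((2^-1)%:E * g ^+ 2 <= (2^-1 * s ^+ 2)%:E)%E -> g = s%:E.
Proof.
move=> s0; case: g => [j| |//]; last first.
  by rewrite expe2 mulyy gt0_muley// lte_fin.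
rewrite lee_fin -EFin_expe -EFinM lee_fin => sj; rewrite ler_pM2l//.
rewrite ler_pXn2r// ?nnegrE ?(le_trans s0)// => js.
by congr EFin; apply/eqP; rewrite eq_le sj andbT.
Qed.

(** * Duality *)
Lemma dual_solution_le {R : realType} {X Y : hilbertType R} {A : X -> Y}
    {K : set X} {b : Y} {eps : R} {y : Y}
    (hy : dual_solution A K b eps y) (y' : Y) :
  2^-1 * support_fun K (adjoint A y) ^+ 2 - inner b y + eps * `|y| <=
  2^-1 * support_fun K (adjoint A y') ^+ 2 - inner b y' + eps * `|y'|.
Proof. by have [_ _ /(_ y' I)] := hy; rewrite lee_fin. Qed.

(** With [h = b - A x], the dual objective changes along [y + t *: h] at rate
at most [inner (A x) h - inner b h + eps * `|h| = `|h| * (eps - `|h|)],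
which is negative as soon as [eps < `|h|]. *)
Lemma dual_solution_feasible {R : realType} {X Y : hilbertType R}
    (A : {linear X -> Y}) (hA : bounded_near A (nbhs (0 : X)))
    (K : set X) (b : Y) (eps : R) (y : Y) (x : X) :
  0 <= eps -> dual_solution A K b eps y ->
  (forall g e, 0 < e -> exists2 r, 0 < r & forall t, 0 < t < r ->
    2^-1 * support_fun K (adjoint A y + t *: g) ^+ 2 <=
    2^-1 * support_fun K (adjoint A y) ^+ 2 + t * (inner g x + e)) ->
  `|A x - b| <= eps.
Proof.
move=> eps0 hy hx; rewrite leNgt; apply/negP => hlt.
rewrite distrC in hlt; set h := b - A x in hlt.
have h0 : 0 < `|h| by exact: le_lt_trans eps0 hlt.
have e0 : 0 < `|h| * (`|h| - eps) by rewrite mulr_gt0// subr_gt0.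
(* Half of the gain [`|h| * (`|h| - eps)] is spent on the error term. *)
have [r r0 hr] := hx (adjoint A h) (2^-1 * (`|h| * (`|h| - eps))) ltac:(lra).
have t0 : 0 < r / 2 by lra.
have := hr (r / 2); rewrite t0 => /(_ ltac:(lra)).
have := dual_solution_le hy (y + (r / 2) *: h).
rewrite (adjointD A hA) (adjointZ A hA) innerDr innerZr.
have := ler_wpM2l eps0 (ler_normD y ((r / 2) *: h)).
rewrite normrZ gtr0_norm// (innerC (adjoint A h) x) -(adjointP A hA).
set t := r / 2 in t0 *.
have : inner b h - inner (A x) h = `|h| ^+ 2.
  by rewrite -inner_norm -innerNl -innerDl.
have := mulr_gt0 t0 e0.
move: (inner b h) (inner (A x) h) => bh Ah + E.
have -> : bh = `|h| ^+ 2 + Ah by lra.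
nra.
Qed.

(** Along the ray [(1 + t) *: y] with [-1 <= t] the dual objective is a quadratic
polynomial in [t] with minimum at 0. *)
Lemma dual_solution_sqr {R : realType} {X Y : hilbertType R}
    (A : {linear X -> Y}) (hA : bounded_near A (nbhs (0 : X)))
    (K : set X) (K_bounded : bounded_set K) (K0 : K 0)
    (b : Y) (eps : R) (y : Y) :
  dual_solution A K b eps y ->
  support_fun K (adjoint A y) ^+ 2 = inner b y - eps * `|y|.
Proof.
move=> hy; apply/eqP; rewrite -subr_eq0; apply/eqP.
apply: (@quadratic_ge0_linear_eq0 _
  (2^-1 * support_fun K (adjoint A y) ^+ 2)) => t.
rewrite ler_norml => /andP[t1 _]; have t10 : 0 <= 1 + t by lra.
have := dual_solution_le hy ((1 + t) *: y).
rewrite (adjointZ A hA) (support_funZ K_bounded K0)// innerZr normrZ ger0_norm//.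
rewrite exprMn; nra.
Qed.

(** Weak duality: [inner (adjoint A y) x = inner (A x) y], and feasibility
costs at most [eps * `|y|] when [A x] is replaced by [b]. *)
Lemma support_sqr_le_inner {R : realType} {X Y : hilbertType R}
    (A : {linear X -> Y}) (hA : bounded_near A (nbhs (0 : X)))
    (K : set X) (K_bounded : bounded_set K) (K0 : K 0)
    (b : Y) (eps : R) (y : Y) (x : X) :
  dual_solution A K b eps y -> `|A x - b| <= eps ->
  support_fun K (adjoint A y) ^+ 2 <= inner (adjoint A y) x.
Proof.
move=> hy xeps; rewrite (dual_solution_sqr _ hA _ K_bounded K0 _ _ _ hy).
rewrite (innerC (adjoint A y) x) -(adjointP A hA).
have := inner_le_norm (b - A x) y; rewrite innerDl innerNl distrC.
have := ler_wpM2r (normr_ge0 y) xeps; lra.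
Qed.

(** Weak duality bounds the gauge of every feasible point below by [s], and the
candidate reaches [s]. A solution therefore has gauge [s], and equality in
weak duality makes it [s] times a maximiser of [inner z] on [K]. *)
Lemma primal_dual_characterization {R : realType} {X Y : hilbertType R}
    (A : {linear X -> Y}) (hA : bounded_near A (nbhs (0 : X)))
    (K : set X) (K_bounded : bounded_set K) (K_closed : closed K)
    (K_convex : convex_set K) (K0 : K 0) (b : Y)
    (eps : R) (y : Y) :
  (~` sing K `|` polar (cone K)) (adjoint A y) ->
  0 <= eps -> dual_solution A K b eps y ->
  exists x, primal_from_dual A K y = [set x] /\
    forall x', primal_solution A K b eps x' <-> x' = x.
Proof.
move=> hsing eps0 hy; set z := adjoint A y in hsing; set s := support_fun K z.
have [x hx xd] := half_sqr_support_deriv K_bounded K_closed K_convex K0 z hsing.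
exists x; split; first exact: hx.
have s0 : 0 <= s by exact: support_fun_ge0.
have xfeas := dual_solution_feasible A hA K b eps y x eps0 hy xd.
have s_le_gauge x' : `|A x' - b| <= eps -> (s%:E <= gauge K x')%E.
  move=> x'feas;
  have := support_sqr_le_inner A hA K K_bounded K0 b eps y x' hy x'feas.
  rewrite -/z -/s.
  case E : (gauge K x') (gauge_ge0 K x') => [j| |]//; rewrite ?leey//.
  rewrite !lee_fin => j0.
  have := inner_le_gauge K_bounded K0 x' z j E; rewrite -/s => zj sz.
  have [->//|sn0] := eqVneq s 0.
  have sp : 0 < s by rewrite lt_neqAle eq_sym sn0.
  by rewrite -(ler_pM2r sp) -expr2 (le_trans sz).
have gx : gauge K x = s%:E.
  apply/eqP; rewrite eq_le s_le_gauge// andbT.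
  have : [set x] x by []. rewrite -hx => -[v [Kv _] <-].
  exact: gauge_le_scale.
move=> x'; split => [[x'feas _ x'min]|->]; last first.
  split => //; first by rewrite gx -EFin_expe -EFinM.
  by move=> x'' x''feas; rewrite gx -EFin_expe -EFinM half_sqr_le// s_le_gauge.
have gx' : gauge K x' = s%:E.
  apply: half_sqr_le_eq => //; first exact: s_le_gauge.
  by have := x'min x xfeas; rewrite gx -EFin_expe -EFinM.
suff : [set x] x' by [].
rewrite -hx -/s; have [s00|sn0] := eqVneq s 0.
  exists 0; last by rewrite scaler0 (gauge_eq0 K_bounded x')// gx' s00.
  by split; rewrite // inner0r -/s s00.
have sp : 0 < s by rewrite lt_neqAle eq_sym sn0.
have Kx' := gauge_attained K_closed x' s sp gx'.
exists (s^-1 *: x'); last by rewrite scalerA mulfV ?scale1r.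
split=> //; apply/eqP; rewrite eq_le support_fun_ub//= innerZr.
rewrite -/s ler_pdivlMl// -expr2.
exact: support_sqr_le_inner hy x'feas.
Qed.

Theorem proposition1p1 (R : realType) (X Y : hilbertType R)
  (A : {linear X -> Y}) (hA : bounded_near A (nbhs (0 : X)))
  (K : set X) (K_bounded : bounded_set K) (K_closed : closed K)
  (K_convex : convex_set K) (K0 : K 0) (b : Y)
  (hsing : forall y : Y,
     (~` sing K `|` polar (cone K)) (adjoint A y)) :
  (* (i) *)
  (forall eps : R, closure (A @` cone K) b -> 0 < eps ->
     forall ye : Y, dual_solution A K b eps ye ->
       (forall xe : X, primal_solution A K b eps xe ->
          [set xe] = primal_from_dual A K ye) /\
       (forall x : X, primal_from_dual A K ye x <->
          primal_solution A K b eps x)) /\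
  (* (ii) *)
  ((A @` cone K) b ->
     forall ys : Y, dual_solution A K b 0 ys ->
       (forall xs : X, primal_solution A K b 0 xs ->
          [set xs] = primal_from_dual A K ys) /\
       (forall x : X, primal_from_dual A K ys x <->
          primal_solution A K b 0 x)).
Proof.
have key eps y : 0 <= eps -> dual_solution A K b eps y ->
    (forall x, primal_solution A K b eps x -> [set x] = primal_from_dual A K y) /\
    (forall x, primal_from_dual A K y x <-> primal_solution A K b eps x).
  move=> eps0 hy.
  have [x [-> xP]] := primal_dual_characterization A hA K K_bounded K_closed
    K_convex K0 b eps y (hsing y) eps0 hy.
  split=> x'; first by move=> /xP ->.
  exact: iff_sym (xP x').
split=> [eps _ /ltW eps0 y|_ y]; exact: key.
Qed.
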